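(* For every $\alpha\in(0,1)$, every randomized online algorithm for non-clairvoyant dynamic bin packing whose expected total migrated size is at most an $\alpha$-fraction of the total size of the items has competitive ratio at least $\frac14\left\lfloor\frac{1}{4\alpha}\right\rfloor$.
   Context: Dynamic bin packing: bins have capacity $1$; items arrive online at times $a_i\ge0$ with size $s_i\in[0,1]$ and duration $d_i>0$ (only the size is revealed at arrival), present during $[a_i,a_i+d_i)$. Each item is placed on arrival into an open bin with enough remaining capacity or a new bin; a migration moves an already placed item to another bin. In the size-cost model each migration of item $i$ costs $s_i$; the total size of the items is $\sum_i s_i$. Cost = total active time $\int_0^\infty(\text{number of nonempty bins at } t)\,dt$; $\mathrm{OPT}(I)=\int_0^\infty\mathrm{OPT}_t\,dt$ with $\mathrm{OPT}_t$ the minimum number of unit bins to pack the items present at time $t$. Competitive ratio at least $\gamma$: for every $\beta<\gamma$ some instance has expected cost $>\beta\,\mathrm{OPT}$. *)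

(* Defs.v *)
From HB Require Import structures.
From mathcomp Require Import all_boot all_order all_algebra.
From mathcomp Require Import all_classical all_reals all_analysis.
From mathcomp Require Import lebesgue_measure measurable_realfun lebesgue_integral probability.
Set Implicit Arguments. Unset Strict Implicit. Unset Printing Implicit Defensive.
Import Order.TTheory GRing.Theory Num.Theory.
Local Open Scope classical_set_scope.
Local Open Scope ring_scope.

Section DBP.
Variable R : realType.

Record item := Item { arr : R; sz : R; dur : R }.
Definition item0 : item := Item 0 0 0.

Definition instance := seq item.

Definition valid_item (x : item) : Prop :=
  0 <= arr x /\ 0 <= sz x <= 1 /\ 0 < dur x.

Definition valid_instance (I : instance) : Prop :=
  (forall i, (i < size I)%N -> valid_item (nth item0 I i)) /\ sorted (fun x y => arr x <= arr y) I.

Definition itm (I : instance) (i : nat) : item := nth item0 I i.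

Definition present (I : instance) (i : nat) (t : R) : bool :=
  (i < size I)%N && (arr (itm I i) <= t) && (t < arr (itm I i) + dur (itm I i)).

Definition total_size (I : instance) : R := \sum_(x <- I) sz x.

(* A migration event: at time [mt], item number [mi] is moved to bin [mb]. *)
Record migration := Mig { mt : R; mi : nat; mb : nat }.

(* A schedule: the bin in which each item is placed on arrival, plus the
   (finite, time-ordered) list of migrations. Bins are named by naturals. *)
Record schedule := Sched { place : nat -> nat; migs : seq migration }.

Definition bin_of (S : schedule) (i : nat) (t : R) : nat :=
  last (place S i) [seq mb e | e <- [seq e <- migs S | (mt e <= t) && (mi e == i)%N]].

Definition load (S : schedule) (I : instance) (b : nat) (t : R) : R :=
  \sum_(i < size I | present I i t && (bin_of S i t == b)) sz (itm I i).

Definition feasible (S : schedule) (I : instance) : Prop :=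
  [/\ sorted (fun e f => mt e <= mt f) (migs S),
      (forall j, (j < size (migs S))%N ->
         let e := nth (Mig 0 0 0) (migs S) j in present I (mi e) (mt e)) &
      (forall b t, load S I b t <= 1)].

Definition nbins (S : schedule) (I : instance) (t : R) : nat :=
  size (undup [seq bin_of S i t | i <- iota 0 (size I) & present I i t]).

Definition cost (S : schedule) (I : instance) : \bar R :=
  (\int[@lebesgue_measure R]_(t in [set: R]) ((nbins S I t)%:R)%:E)%E.

Definition mig_cost (S : schedule) (I : instance) : R :=
  \sum_(e <- migs S) sz (itm I (mi e)).

Definition packable (I : instance) (t : R) (k : nat) : Prop :=
  exists f : nat -> nat,
    (forall i, present I i t -> (f i < k)%N) /\
    (forall b : nat,
        \sum_(i < size I | present I i t && (f i == b)) sz (itm I i) <= 1).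

Definition opt_t (I : instance) (t : R) : \bar R :=
  ereal_inf [set ((k%:R : R)%:E) | k in packable I t].

Definition OPT (I : instance) : \bar R :=
  (\int[@lebesgue_measure R]_(t in [set: R]) opt_t I t)%E.

(* What a non-clairvoyant algorithm has seen at time t: for every arrived
   item its arrival time, size, and departure time if it has departed. *)
Definition view (t : R) (x : item) : R * R * option R :=
  (arr x, sz x, if arr x + dur x <= t then Some (arr x + dur x) else None).

Definition arrived (t : R) (I : instance) : instance :=
  [seq x <- I | arr x <= t].

Definition same_view (t : R) (I J : instance) : Prop :=
  [seq view t x | x <- arrived t I] = [seq view t x | x <- arrived t J].

Definition agree_until (t : R) (S1 S2 : schedule) : Prop :=
  [seq e <- migs S1 | mt e <= t] = [seq e <- migs S2 | mt e <= t].

Definition det_alg := instance -> schedule.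

(* A deterministic online non-clairvoyant algorithm with migrations:
   - it produces a feasible schedule on every valid instance;
   - the placement of item i (at its arrival time a_i) depends only on what
     has been seen at time a_i of the items 0..i (items arrive one by one,
     in list order, so items listed after i are not yet known);
   - migrations performed up to time t depend only on what has been seen by
     time t. *)
Definition online_alg (A : det_alg) : Prop :=
  [/\ (forall I, valid_instance I -> feasible (A I) I),
      (forall I J i, valid_instance I -> valid_instance J ->
         (i < size I)%N ->
         [seq view (arr (itm I i)) x | x <- take i.+1 I] =
         [seq view (arr (itm I i)) x | x <- take i.+1 J] ->
         place (A I) i = place (A J) i) &
      (forall I J t, valid_instance I -> valid_instance J -> same_view t I J ->
         agree_until t (A I) (A J))].

End DBP.

(* Main.v *)
(** With [n] the integer part of [1 / (4 alpha)], release [n^2] items of size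
    [1 / n] at time 0, in [n] blocks of [n].  In each block one uniformly random
    item survives until time [1 + L]; all others leave at time 1.  The packing at
    time 0 cannot depend on the choice of the survivors, and a bin holds at most
    [n] items, so the survivors occupy at least [n / 2] of these bins on average.
    The budget pays for [n / 4] migrations on average, each of which empties at
    most one bin, hence [n / 4] bins stay open during [[1, 1 + L)], where a single
    bin would do.  Averaging over the survivors fixes one bad instance, and the
    ratio tends to [n / 4] as [L] grows. *)

Require Import Defs.
From HB Require Import structures.
From mathcomp Require Import all_boot all_order all_algebra.
From mathcomp Require Import all_classical all_reals all_analysis.
From mathcomp Require Import lebesgue_measure measurable_realfun lebesgue_integral probability.
From mathcomp Require Import ring lra.
Import Order.TTheory GRing.Theory Num.Theory.
Local Open Scope classical_set_scope.
Local Open Scope ring_scope.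
Set Implicit Arguments.
Unset Strict Implicit.
Unset Printing Implicit Defensive.

(** * Integrals of possibly non-measurable functions *)

Section nonmeasurable_integral.
Local Open Scope ereal_scope.
Context (d : measure_display) (T : measurableType d) (R : realType)
  (mu : {measure set T -> \bar R}).

(* Unlike [ge0_le_integral], no measurability is needed: the integral of a
   nonnegative function is a supremum over the simple functions below it. *)
Lemma ge0_le_integral_nonmeasurable (f g : T -> \bar R) :
  (forall x, 0 <= f x) -> (forall x, f x <= g x) ->
  \int[mu]_x f x <= \int[mu]_x g x.
Proof.
move=> f0 fg; have g0 x : 0 <= g x := le_trans (f0 x) (fg x).
rewrite !ge0_integralE// !patch_setT; apply: le_ereal_sup => _ [h hf <-].
by exists h => // x; exact: le_trans (hf x) (fg x).
Qed.

End nonmeasurable_integral.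

Lemma ge0_le_expectation_cst (d : measure_display) (T : measurableType d)
    (R : realType) (P : probability T R) (c : R) (f : T -> \bar R) :
  (0 <= c)%R -> (forall w, c%:E <= f w)%E -> (c%:E <= \int[P]_w f w)%E.
Proof.
move=> c0 cf; rewrite -[leLHS]mule1 -(probability_setT P) -integral_cst//.
by apply: ge0_le_integral_nonmeasurable => // w; rewrite lee_fin.
Qed.

Section interval_integral.
Local Open Scope ereal_scope.
Context (R : realType).
Notation mu := (@lebesgue_measure R).

Lemma integral_cst_itvco (a b c : R) : (a <= b)%R ->
  \int[mu]_x ((cst c%:E) \_ `[a, b[) x = (c * (b - a))%:E.
Proof.
move=> ab; rewrite -integral_mkcond integral_cst//= lebesgue_measure_itv/= lte_fin.
move: ab; rewrite le_eqVlt => /predU1P[->|ab].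
  by rewrite ltxx subrr mulr0 mule0.
by rewrite ab -EFinB -EFinM.
Qed.

Lemma ge_integral_itvco (a b c : R) (f : R -> \bar R) :
  (a <= b)%R -> (0 <= c)%R -> (forall t, 0 <= f t) ->
  (forall t, (a <= t < b)%R -> c%:E <= f t) ->
  (c * (b - a))%:E <= \int[mu]_t f t.
Proof.
move=> ab c0 f0 cf; rewrite -integral_cst_itvco//.
apply: ge0_le_integral_nonmeasurable => x; rewrite patchE/=.
  by case: ifP => // _; rewrite lee_fin.
by case: ifPn => // /[!inE]/=; rewrite in_itv/= => /cf.
Qed.

End interval_integral.

(** * Expected number of bins hit by one random item per block *)

Section transversal.
Context (R : realFieldType).

(** For [x, s >= 0], [(1 - x)(1 + x + s) = 1 + s - x(x + s) <= 1 + s], so each new factor preserves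
    the bound. *)
Lemma prod_subr_mul_addr_le1 (I : Type) (r : seq I) (x : I -> R) :
  (forall i, 0 <= x i <= 1) ->
  0 <= \prod_(i <- r) (1 - x i) /\
  \prod_(i <- r) (1 - x i) * (1 + \sum_(i <- r) x i) <= 1.
Proof.
move=> x01; elim: r => [|i r [IH0 IH]]; first by rewrite !big_nil addr0 mulr1.
have /andP[xi0 xi1] := x01 i.
have s0 : 0 <= \sum_(i <- r) x i by apply: sumr_ge0 => j _; case/andP: (x01 j).
rewrite !big_cons; split; first by rewrite mulr_ge0// subr_ge0.
move: IH0 IH s0; set p := \prod_(_ <- _) _; set s := \sum_(_ <- _) _ => p0 ps s0.
have := mulr_ge0 p0 (mulr_ge0 xi0 (addr_ge0 xi0 s0)); nra.
Qed.

(* The probability that a bin holding an [X]-fraction of its capacity is hit is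
   at least [1 - 1 / (1 + X) >= X / 2]. *)
Lemma sum_transversal_bins (n : nat) (f : 'I_n -> 'I_n -> nat) :
  (0 < n)%N ->
  (forall b, \sum_(j < n) \sum_(a < n) ((f j a == b)%:R : R) <= n%:R) ->
  (n ^ n)%:R * (n%:R / 2) <=
  \sum_(s : {ffun 'I_n -> 'I_n})
     ((size (undup [seq f j (s j) | j <- enum 'I_n]))%:R : R).
Proof.
move=> n0 fib; have nR0 : 0 < n%:R :> R by rewrite ltr0n.
(* All bins that ever occur. In [hit], a bin contributes 1 minus the product of its miss
   indicators. *)
pose B := undup [seq f p.1 p.2 | p <- enum {: 'I_n * 'I_n}].
have fB j a : f j a \in B.
  by rewrite mem_undup; apply/mapP; exists (j, a) => //; rewrite mem_enum.
have hit (s : {ffun 'I_n -> 'I_n}) :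
    (size (undup [seq f j (s j) | j <- enum 'I_n]))%:R =
    \sum_(b <- B) (1 - \prod_(j < n) ((f j (s j) != b)%:R)) :> R.
  set r := [seq _ | _ <- _].
  have -> : size (undup r) = (\sum_(b <- B) (b \in r))%N.
    rewrite -sum1_size -[RHS]big_mkcond/= -[RHS]big_filter; apply: perm_big.
    apply: uniq_perm; rewrite ?undup_uniq ?filter_uniq ?undup_uniq// => b.
    rewrite mem_filter mem_undup andb_idr// => /mapP[j _ ->]; exact: fB.
  rewrite natr_sum; apply: eq_bigr => b _.
  have [/mapP[j _ ->]|br] := boolP (b \in r).
    by rewrite (bigD1 j)//= eqxx mul0r subr0.
  rewrite big1 ?subrr// => j _; suff -> : f j (s j) != b by [].
  by apply: contra br => /eqP <-; apply: map_f; rewrite mem_enum.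
rewrite (eq_bigr _ (fun s _ => hit s)) exchange_big/=.
have nE : n%:R = \sum_(a < n) 1 :> R by rewrite sumr_const card_ord.
(* Probability that the random item of block [j] lies in bin [b]. *)
pose x b j : R := (\sum_(a < n) (f j a == b)%:R) / n%:R.
have x01 b j : 0 <= x b j <= 1.
  rewrite divr_ge0 ?sumr_ge0//= ler_pdivrMr// mul1r.
  rewrite nE.
  by apply: ler_sum => a _; case: eqP.
have miss b : \sum_(s : {ffun 'I_n -> 'I_n})
      (1 - \prod_(j < n) ((f j (s j) != b)%:R)) =
    (n ^ n)%:R * (1 - \prod_(j < n) (1 - x b j)) :> R.
  rewrite sumrB sumr_const card_ffun !card_ord mulrBr mulr1; congr (_ - _).
  (* Independence of the blocks: the sum over choice functions of a product is the product of the
     blockwise sums. *)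
  rewrite -(bigA_distr_bigA (fun j a => (f j a != b)%:R)) natrX.
  have -> : n%:R ^+ n = \prod_(j < n) n%:R :> R by rewrite prodr_const card_ord.
  rewrite -big_split/=; apply: eq_bigr => j _.
  rewrite mulrBr mulr1 mulrC divfK ?gt_eqF//.
  rewrite nE -sumrB.
  by apply: eq_bigr => a _; case: eqP; rewrite (subrr, subr0).
rewrite (eq_bigr _ (fun b _ => miss b)) -mulr_sumr ler_wpM2l//.
have X b : \sum_(j < n) x b j / 2 <= 1 - \prod_(j < n) (1 - x b j).
  have [p0 ps] := prod_subr_mul_addr_le1 (index_enum 'I_n) (x01 b).
  (* The capacity bound enters here. *)
  have s1 : \sum_(j < n) x b j <= 1.
    by rewrite -mulr_suml ler_pdivrMr// mul1r.
  have s0 : 0 <= \sum_(j < n) x b j.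
    by apply: sumr_ge0 => j _; case/andP: (x01 b j).
  rewrite -mulr_suml; move: p0 ps s1 s0.
  set p := \prod_(_ <- _) _; set s := \sum_(_ <- _) _ => p0 ps s1 s0.
  nra.
apply: le_trans (ler_sum _ (fun b _ => X b)).
rewrite exchange_big/=.
(* Each item lies in exactly one bin, so the probabilities of a block sum to 1 over the bins. *)
have tot j : \sum_(b <- B) x b j / 2 = 2^-1.
  rewrite -mulr_suml -mulr_suml exchange_big/=.
  under eq_bigr => a _.
    rewrite (bigD1_seq (f j a)) ?fB ?undup_uniq//= eqxx big1 ?addr0; last first.
      by move=> b /negPf; rewrite eq_sym => ->.
    over.
  by rewrite sumr_const card_ord divff ?gt_eqF// mul1r.
by rewrite (eq_bigr _ (fun j _ => tot j)) sumr_const card_ord -[leRHS]mulr_natl.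
Qed.

End transversal.

(** * Instances whose items all arrive at time 0 with the same size *)

Section batch.
Context (R : realType) (T : finType).

Definition batch (s : R) (dr : T -> R) : instance R :=
  [seq Item 0 s (dr p) | p <- enum T].

Lemma size_batch s dr : size (batch s dr) = #|T|.
Proof. by rewrite size_map cardT. Qed.

Lemma itm_batch s dr (p : T) : itm (batch s dr) (enum_rank p) = Item 0 s (dr p).
Proof.
rewrite /itm (nth_map p) ?nth_enum_rank// -cardT; exact: ltn_ord.
Qed.

Lemma ltn_card_enum_rank (i : nat) :
  (i < #|T|)%N -> exists p : T, i = enum_rank p.
Proof. by move=> iT; exists (enum_val (Ordinal iT)); rewrite enum_valK. Qed.

Lemma present_batch s dr (p : T) t :
  present (batch s dr) (enum_rank p) t = (0 <= t < dr p).
Proof. by rewrite /present itm_batch size_batch ltn_ord/= add0r. Qed.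

Lemma valid_batch s dr : 0 <= s <= 1 -> (forall p, 0 < dr p) ->
  valid_instance (batch s dr).
Proof.
move=> s01 dr0; split=> [i|].
  rewrite size_batch => /ltn_card_enum_rank[p ->].
  by have := itm_batch s dr p; rewrite /itm => ->; split=> //=; split.
rewrite sorted_map; elim: (enum T) => //= p [|q r] //= ->.
by rewrite lexx.
Qed.

Lemma total_size_batch s dr : total_size (batch s dr) = s *+ #|T|.
Proof. by rewrite /total_size big_map big_enum sumr_const. Qed.

(** Feasibility excludes migrations of indices outside the batch, which would have the default size
    0. *)
Lemma mig_cost_batch s dr (S : schedule R) : feasible S (batch s dr) ->
  mig_cost S (batch s dr) = s *+ size (migs S).
Proof.
case=> _ pres _; rewrite /mig_cost (big_nth (Mig 0 0 0)) big_mkord.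
rewrite -[in RHS](card_ord (size _)) -sumr_const; apply: eq_bigr => j _.
have /andP[/andP[]] := pres j (ltn_ord j).
by rewrite size_batch => /ltn_card_enum_rank[p ->]; rewrite itm_batch.
Qed.

Lemma sum_batch s dr (Q : nat -> bool) :
  \sum_(i < size (batch s dr) | Q i) sz (itm (batch s dr) i) =
  \sum_(p : T | Q (enum_rank p)) s.
Proof.
rewrite size_batch (reindex (@enum_rank T))/=; last first.
  exact/onW_bij/enum_rank_bij.
by apply: eq_bigr => p _; rewrite itm_batch.
Qed.

(* Two batches that differ only in their durations look the same at time 0, so
   the packing at that time does not depend on the durations. *)
Lemma bin_of_batch0 (A : det_alg R) s dr dr' (p : T) :
  online_alg A -> 0 <= s <= 1 -> (forall q, 0 < dr q) -> (forall q, 0 < dr' q) ->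
  bin_of (A (batch s dr)) (enum_rank p) 0 =
  bin_of (A (batch s dr')) (enum_rank p) 0.
Proof.
move=> [_ placeA migA] s01 dr0 dr0'.
have vI := valid_batch s01 dr0; have vJ := valid_batch s01 dr0'.
have viewE (f g : T -> R) (r : seq T) :
    (forall q, 0 < f q) -> (forall q, 0 < g q) ->
    [seq view 0 x | x <- [seq Item 0 s (f p) | p <- r]] =
    [seq view 0 x | x <- [seq Item 0 s (g p) | p <- r]].
  move=> f0 g0; rewrite -!map_comp; apply: eq_map => q.
  by rewrite /view/= !add0r !leNgt f0 g0.
have arrE f : arrived 0 (batch s f) = batch s f.
  by apply/all_filterP; rewrite all_map; apply/allP => q _ /=.
have sv : same_view 0 (batch s dr) (batch s dr').
  by rewrite /same_view !arrE; exact: viewE.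
have /(congr1 (seq.filter (fun e => mi e == enum_rank p :> nat)))
  := migA _ _ _ vI vJ sv.
rewrite -!filter_predI /bin_of (placeA _ _ _ vI vJ).
- under eq_filter do rewrite /= andbC; move=> ->.
  by congr (last _ (map _ _)); apply: eq_filter => e /=; rewrite andbC.
- by rewrite size_batch.
- by rewrite itm_batch/= -!map_take; exact: viewE.
Qed.

(** Yields the capacity hypothesis of [sum_transversal_bins] at a time when the whole batch is
    present. *)
Lemma sum_bin_of_batch_le s dr (S : schedule R) t b :
  feasible S (batch s dr) -> (forall p, 0 <= t < dr p) ->
  s * \sum_(p : T) (bin_of S (enum_rank p) t == b)%:R <= 1.
Proof.
move=> [_ _ /(_ b t)] + pt; apply: le_trans.
rewrite /load (sum_batch s dr (fun i => present _ i t && (bin_of S i t == b))).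
rewrite mulr_sumr [leRHS]big_mkcond/=.
apply: ler_sum => p _; rewrite present_batch pt/=.
by case: eqP; rewrite (mulr1, mulr0).
Qed.

(** An item that never migrates keeps its bin, which is open at [t]. Any other bin of the list is
    charged to a migration of one of its items. *)
Lemma le_nbins_batch s dr (S : schedule R) t (r : seq T) :
  (forall p, p \in r -> 0 <= t < dr p) ->
  (size (undup [seq bin_of S (enum_rank p) 0 | p <- r]) <=
   nbins S (batch s dr) t + size (migs S))%N.
Proof.
move=> rt; rewrite /nbins; set u := [seq bin_of S i t | i <- _].
rewrite -(size_map (@mi R)) -(size_map (fun i => bin_of S i 0)) -size_cat.
apply: uniq_leq_size; first exact: undup_uniq.
move=> b; rewrite mem_undup mem_cat mem_undup => /mapP[p pr ->].
have [mp|nomig] := boolP ((enum_rank p : nat) \in [seq mi e | e <- migs S]).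
  by rewrite (map_f (fun i => bin_of S i 0)) ?orbT.
have still u' : bin_of S (enum_rank p) u' = place S (enum_rank p).
  move: nomig; rewrite -has_pred1 has_map has_count -size_filter -eqn0Ngt.
  by move=> /eqP/size0nil nomig; rewrite /bin_of filter_predI nomig.
rewrite (still 0) -(still t) (map_f (fun i => bin_of S i t))// mem_filter present_batch rt//.
by rewrite mem_iota size_batch ltn_ord.
Qed.

Lemma packable_batch s dr t (f : T -> nat) k :
  (forall p, 0 <= t < dr p -> (f p < k)%N) ->
  (forall b, \sum_(p : T | (0 <= t < dr p) && (f p == b)) s <= 1) ->
  packable (batch s dr) t k.
Proof.
move=> fk fb.
(* Transports [f] from [T] to list indices; the value 0 out of range is never consulted. *)
pose g i := if (insub i : option 'I_#|T|) is Some o then f (enum_val o) else 0%N.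
have gE p : g (enum_rank p) = f p by rewrite /g valK enum_rankK.
exists g; split=> [i pit|b].
  have : (i < #|T|)%N by case/andP: pit => /andP[]; rewrite size_batch.
  move=> /ltn_card_enum_rank[p pE]; move: pit.
  by rewrite pE present_batch gE => /fk.
rewrite (sum_batch s dr (fun i => present _ i t && (g i == b))).
by under eq_bigl do rewrite present_batch gE.
Qed.

End batch.

(** * Bounds on the cost of a schedule and on the optimum *)

Section schedule_cost.
Local Open Scope ereal_scope.
Context (R : realType).
Implicit Types (S : schedule R) (I : instance R).

Lemma nbins_gt0 S I i t : present I i t -> (0 < nbins S I t)%N.
Proof.
move=> pit; rewrite /nbins.
have : bin_of S i t \in
    undup [seq bin_of S j t | j <- iota 0 (size I) & present I j t].
  rewrite mem_undup (map_f (fun j => bin_of S j t))// mem_filter pit mem_iota.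
  by case/andP: pit => /andP[].
by case: (undup _).
Qed.

Lemma ge_cost S I (a b : R) (n : nat) : (a <= b)%R ->
  (forall t, (a <= t < b)%R -> (n <= nbins S I t)%N) ->
  (n%:R * (b - a))%:E <= cost S I.
Proof.
move=> ab nS; apply: ge_integral_itvco => // t /nS nt.
by rewrite lee_fin ler_nat.
Qed.

Lemma cost_ge0 S I : 0 <= cost S I.
Proof. by apply: integral_ge0 => t _; rewrite lee_fin. Qed.

Lemma mig_cost_ge0 S I : feasible S I -> valid_instance I ->
  (0 <= mig_cost S I)%R.
Proof.
move=> [_ pres _] [vI _]; rewrite /mig_cost (big_nth (Mig 0 0 0)) big_mkord.
apply: sumr_ge0 => j _; have /andP[/andP[/vI + _] _] := pres j (ltn_ord j).
by case=> _ [/andP[]].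
Qed.

Lemma opt_t_ge0 I t : 0 <= opt_t I t.
Proof. by apply: le_ereal_inf_tmp => _ [k _ <-]; rewrite lee_fin. Qed.

Lemma opt_t_le I t k : packable I t k -> opt_t I t <= k%:R%:E.
Proof. by move=> pk; apply: ereal_inf_lbound; exists k. Qed.

Lemma OPT_ge0 I : 0 <= OPT I.
Proof. by apply: integral_ge0 => t _; exact: opt_t_ge0. Qed.

End schedule_cost.

(** * The hard instances *)

Section hard_instance.
Context (R : realType) (n : nat) (L : R) (n0 : (0 < n)%N) (L0 : 0 <= L).

(** Item [(j, a)] belongs to block [j], whose survivor is [s j]. A uniform [s] makes the survivors
    independent, and the average over [s] is a finite sum. *)
Definition hard (s : {ffun 'I_n -> 'I_n}) : instance R :=
  batch n%:R^-1
    (fun p : 'I_n * 'I_n => if s p.1 == p.2 then 1 + L else 1).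

Let n_gt0 : 0 < n%:R :> R. Proof. by rewrite ltr0n. Qed.

Let size_ge0_le1 : 0 <= (n%:R^-1 : R) <= 1.
Proof. by rewrite invr_ge0 ler0n/= invf_le1// ler1n. Qed.

Let hard_dur_gt0 (s : {ffun 'I_n -> 'I_n}) (p : 'I_n * 'I_n) :
  0 < (if s p.1 == p.2 then 1 + L else 1).
Proof. by case: ifP => _; rewrite ?ltr01// ltr_pwDl. Qed.

Lemma valid_hard s : valid_instance (hard s).
Proof. exact: valid_batch. Qed.

Lemma total_size_hard s : total_size (hard s) = n%:R.
Proof.
rewrite total_size_batch card_prod !card_ord -[LHS]mulr_natl natrM -mulrA.
by rewrite divff ?mulr1// gt_eqF.
Qed.

Lemma mig_cost_hard s (S : schedule R) : feasible S (hard s) ->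
  n%:R * mig_cost S (hard s) = (size (migs S))%:R.
Proof.
by move=> fS; rewrite mig_cost_batch// -[X in _ * X]mulr_natl mulrCA divff ?mulr1// gt_eqF.
Qed.

Lemma sum_inj_le1 (T : finType) (Q : pred T) (g : T -> 'I_n) :
  {in Q &, injective g} -> \sum_(p | Q p) n%:R^-1 <= 1 :> R.
Proof.
move=> injg; rewrite sumr_const -[leLHS]mulr_natl ler_pdivrMr// mul1r ler_nat.
by rewrite -[leqRHS](card_ord n) -(card_in_imset injg) max_card.
Qed.

(** On [[0, 1)] each block fills one bin; on [[1, 1 + L)] the [n] survivors share a single bin. *)
Lemma OPT_hard s : (OPT (hard s) <= (n%:R + L)%:E)%E.
Proof.
(* Writes the bound as the integral of the step function [n] on [[0, 1)], 1 on [[1, 1 + L)]. *)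
have {1}-> : L = 1 * (1 + L - 1) by ring.
have {1}-> : n%:R = n%:R * (1 - 0) :> R by ring.
rewrite EFinD -!integral_cst_itvco ?lerDl// -ge0_integralD//=; last 4 first.
- by move=> t _; rewrite patchE; case: ifP => // _; rewrite lee_fin.
- exact/(measurable_restrictT _ (measurable_itv _)).
- by move=> t _; rewrite patchE; case: ifP => // _; rewrite lee_fin.
- exact/(measurable_restrictT _ (measurable_itv _)).
apply: ge0_le_integral_nonmeasurable => t; first exact: opt_t_ge0.
have mem_itvco (a b : R) : (t \in `[a, b[%classic) = (a <= t < b).
  by rewrite mem_setE in_itv.
rewrite !patchE !mem_itvco.
have [t0|t0] := ltP t 0.
  rewrite (lt_geF (lt_trans t0 ltr01))/= adde0; apply: (opt_t_le (k := 0)).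
  apply: (@packable_batch _ _ _ _ _ (fun=> 0%N)) => [p|b].
    by rewrite (lt_geF t0).
  by rewrite big1// => p; rewrite (lt_geF t0).
have [t1|t1] := ltP t 1.
  rewrite /= adde0; apply: (opt_t_le (k := n)).
  apply: (@packable_batch _ _ _ _ _ (fun p : 'I_n * 'I_n => p.1 : nat)) => [[j a]//|b].
  apply: (@sum_inj_le1 _ _ snd) => -[j a] [j' a'] /andP[_ /eqP/= jb].
  by move=> /andP[_ /eqP/= jb'] ->; congr pair; apply: ord_inj; rewrite jb jb'.
rewrite /= add0e; have [tL|tL] := ltP t (1 + L).
  apply: (opt_t_le (k := 1)).
  apply: (@packable_batch _ _ _ _ _ (fun=> 0%N)) => // b.
  apply: (@sum_inj_le1 _ _ fst) => -[j a] [j' a'] /andP[/andP[_ +] _].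
  rewrite /=; case: eqP => [<- _|_]; last by rewrite ltNge t1.
  move=> /andP[/andP[_ +] _]; rewrite /=.
  by case: eqP => [<- _ ->//|_]; last by rewrite ltNge t1.
have dead p : (0 <= t < (if s p.1 == p.2 then 1 + L else 1)) = false.
  by apply/negbTE; rewrite negb_and -!leNgt orbC; case: ifP => _; rewrite ?tL ?t1.
apply: (opt_t_le (k := 0)).
apply: (@packable_batch _ _ _ _ _ (fun=> 0%N)) => [p|b]; first by rewrite dead.
by rewrite big1// => p; rewrite dead.
Qed.

(** * One deterministic algorithm against all hard instances *)

Section pointwise.
Context (A : det_alg R) (onA : online_alg A).

(* [finfun id] is arbitrary: by [bin_of_batch0] every [hard s] is packed in this
   way at time 0. *)
Let bin0 (j a : 'I_n) : nat :=
  bin_of (A (hard (finfun id))) (enum_rank (j, a)) 0.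

Let feas s : feasible (A (hard s)) (hard s).
Proof. by case: onA => fA _ _; apply/fA/valid_hard. Qed.

(** A migration costs [1 / n] and saves at most one bin for time [L]. Keeping this saving as a
    linear term lets the bound pass to expectations. *)
Lemma cost_hard (s : {ffun 'I_n -> 'I_n}) :
  ((L * (size (undup [seq bin0 j (s j) | j <- enum 'I_n]))%:R)%:E <=
   cost (A (hard s)) (hard s) +
   (L * n%:R)%:E * (mig_cost (A (hard s)) (hard s))%:E)%E.
Proof.
rewrite -EFinM -mulrA (mig_cost_hard (feas s)).
have -> : [seq bin0 j (s j) | j <- enum 'I_n] =
    [seq bin_of (A (hard s)) (enum_rank p) 0 | p <- [seq (j, s j) | j <- enum 'I_n]].
  rewrite -[RHS]map_comp; apply: eq_map => j; exact: bin_of_batch0.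
set D := size (undup _); set M := size (migs _).
(* Truncated subtraction: if [M] exceeds [D] this claims only nonnegativity, and [D <= (D - M) + M]
   still holds. *)
have DM : (((D - M)%N%:R * (1 + L - 1))%:E <= cost (A (hard s)) (hard s))%E.
  apply: ge_cost => [|t /andP[t1 tL]]; first by rewrite lerDl.
  rewrite leq_subLR addnC; apply: le_nbins_batch => _ /mapP[j _ ->]/=.
  by rewrite eqxx tL (le_trans ler01).
apply: le_trans (leeD2r _ DM); rewrite -EFinD lee_fin.
have -> : 1 + L - 1 = L by ring.
rewrite [X in X + _]mulrC -mulrDr ler_wpM2l// -natrD ler_nat.
by rewrite addnC -leq_subLR.
Qed.

Lemma sum_cost_hard :
  ((L * ((n ^ n)%:R * (n%:R / 2)))%:E <=
   \sum_(s : {ffun 'I_n -> 'I_n}) (cost (A (hard s)) (hard s) +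
   (L * n%:R)%:E * (mig_cost (A (hard s)) (hard s))%:E))%E.
Proof.
apply: le_trans (lee_sum _ (fun s _ => cost_hard s)).
rewrite sumEFin lee_fin -mulr_sumr ler_wpM2l//; apply: sum_transversal_bins => // b.
have := sum_bin_of_batch_le b (feas (finfun id))
  (fun p => introT andP (conj (lexx 0) (hard_dur_gt0 _ p))).
rewrite mulrC ler_pdivrMr// mul1r; apply: le_trans.
by rewrite pair_bigA/=; apply: ler_sum => -[j a].
Qed.

End pointwise.

End hard_instance.

(** * The lower bound for randomized algorithms *)

Lemma exists_unit_cost (R : realType) :
  exists2 I : instance R, valid_instance I &
    forall S : schedule R, (1 <= cost S I)%E.
Proof.
exists (@batch R unit 1 (fun=> 1)).
  by apply: valid_batch => [|_]; rewrite ?ler01 ?lexx ?ltr01.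
move=> S; have := @ge_cost R S (@batch R unit 1 (fun=> 1)) 0 1 1.
rewrite subr0 mulr1; apply=> // t t01.
by apply: (@nbins_gt0 _ _ _ (enum_rank tt)); rewrite present_batch.
Qed.

(* A randomized algorithm is a random choice (on a probability space P) of a
   deterministic online algorithm A w. *)
Theorem theorem23 (R : realType) (alpha : R) (d : measure_display)
  (Omega : measurableType d) (P : probability Omega R)
  (A : Omega -> det_alg R) :
  0 < alpha < 1 ->
  (forall w, online_alg (A w)) ->
  (forall I : instance R, valid_instance I ->
     measurable_fun [set: Omega] (fun w => cost (A w I) I) /\
     measurable_fun [set: Omega] (fun w => mig_cost (A w I) I)) ->
  (forall I : instance R, valid_instance I ->
     (\int[P]_(w in [set: Omega]) (mig_cost (A w I) I)%:E
        <= (alpha * total_size I)%:E)%E) ->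
  forall beta : R,
    beta < ((Num.floor ((4 * alpha)^-1))%:~R) / 4 ->
    exists I : instance R, valid_instance I /\
      (beta%:E * OPT I < \int[P]_(w in [set: Omega]) cost (A w I) I)%E.
Proof.
move=> /andP[alpha0 _] onA mA migA beta.
set K := Num.floor _ => betaK.
(* For negative [beta] any instance of positive cost works. Otherwise [K > 0], and [beta] may
   multiply the bound on [OPT]. *)
have [beta0|beta0] := ltP beta 0.
  have [I vI cI] := exists_unit_cost R; exists I; split => //.
  apply: (@le_lt_trans _ _ 0%E).
    by rewrite mule_le0_ge0 ?OPT_ge0// lee_fin ltW.
  exact/(lt_le_trans lte01)/ge0_le_expectation_cst.
have K0 : 0 < K by rewrite -(ltr0z R); lra.
have [n KE] : exists n, K = n%:Z by case: (K) K0 => // m _; exists m.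
have n0 : (0 < n)%N by rewrite KE in K0.
rewrite KE -pmulrn in betaK.
have nR0 : 0 < n%:R :> R by rewrite ltr0n.
(* The budget on [hard], whose total size is [n]. *)
have alphan : alpha * n%:R <= 4^-1.
  have : K%:~R <= (4 * alpha)^-1 by exact: floor_le_tmp.
  by rewrite KE -pmulrn invfM ler_pdivlMr// mulrC.
(* [L] solves [L (n / 4 - beta) = beta n + 1], so the gain on the long phase exceeds [beta n], the
   share of the first time unit. *)
have [L L0 betaL] : exists2 L : R, 0 <= L & beta * (n%:R + L) < L * n%:R / 4.
  have gap : 0 < n%:R / 4 - beta by rewrite subr_gt0.
  exists ((beta * n%:R + 1) / (n%:R / 4 - beta)).
    by rewrite divr_ge0 ?ltW// ltr_pwDr// mulr_ge0// ltW.
  set L := (beta * n%:R + 1) / _.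
  have : L * (n%:R / 4 - beta) = beta * n%:R + 1 by rewrite /L divfK ?gt_eqF.
  lra.
apply: contrapT => noI.
pose C (s : {ffun 'I_n -> 'I_n}) := (\int[P]_(w in [set: Omega]) cost (A w (hard L s)) (hard L s))%E.
have C_le (s : {ffun 'I_n -> 'I_n}) : (C s <= (beta * (n%:R + L))%:E)%E.
  apply: (@le_trans _ _ (beta%:E * OPT (hard L s))%E); last first.
    by rewrite EFinM lee_wpmul2l ?lee_fin// OPT_hard.
  rewrite leNgt; apply/negP => lt_C; apply: noI.
  by exists (hard L s); split => //; exact: valid_hard.
have mig_ge0 (s : {ffun 'I_n -> 'I_n}) w : (0 <= (mig_cost (A w (hard L s)) (hard L s))%:E)%E.
  have [fA _ _] := onA w; have vI := valid_hard n0 L0 s.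
  by rewrite lee_fin mig_cost_ge0//; exact: fA.
have M_le (s : {ffun 'I_n -> 'I_n}) : (\int[P]_(w in [set: Omega])
    (mig_cost (A w (hard L s)) (hard L s))%:E <= (4^-1)%:E)%E.
  apply: le_trans (migA _ (valid_hard n0 L0 s)) _.
  by rewrite total_size_hard// lee_fin.
have mM (s : {ffun 'I_n -> 'I_n}) : measurable_fun [set: Omega]
    (fun w => (mig_cost (A w (hard L s)) (hard L s))%:E).
  by apply/measurable_EFinP; case: (mA _ (valid_hard n0 L0 s)).
have mC (s : {ffun 'I_n -> 'I_n}) : measurable_fun [set: Omega]
    (fun w => cost (A w (hard L s)) (hard L s)).
  by case: (mA _ (valid_hard n0 L0 s)).
have Ln0 : (0 <= (L * n%:R)%:E)%E by rewrite lee_fin mulr_ge0.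
(* Holds run by run. Under [noI] the same integral is at most [n ^ n] times
   [beta (n + L) + L n / 4], which by [betaL] is too small. *)
have : ((L * ((n ^ n)%:R * (n%:R / 2)))%:E <=
    \int[P]_(w in [set: Omega]) (\sum_(s : {ffun 'I_n -> 'I_n})
      (cost (A w (hard L s)) (hard L s) +
       (L * n%:R)%:E * (mig_cost (A w (hard L s)) (hard L s))%:E)))%E.
  apply: ge0_le_expectation_cst => [|w]; last exact: sum_cost_hard.
  by rewrite mulr_ge0 ?mulr_ge0 ?divr_ge0 ?ler0n.
rewrite ge0_integral_sum//; last 2 first.
- by move=> s; apply: emeasurable_funD => //; exact: measurable_funeM.
- by move=> s w _; rewrite adde_ge0 ?cost_ge0// mule_ge0.
apply/negP; rewrite -ltNge.
apply: (@le_lt_trans _ _ (\sum_(s : {ffun 'I_n -> 'I_n})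
    (beta * (n%:R + L) + L * n%:R / 4)%:E)%E).
  apply: lee_sum => s _; rewrite ge0_integralD//; last 3 first.
  - by move=> w _; rewrite cost_ge0.
  - by move=> w _; rewrite mule_ge0.
  - exact: measurable_funeM.
  by rewrite EFinD leeD ?C_le// ge0_integralZl// [leRHS]EFinM lee_wpmul2l.
rewrite sumEFin lte_fin sumr_const card_ffun !card_ord -[ltLHS]mulr_natl [ltRHS]mulrCA.
by rewrite ltr_pM2l ?ltr0n ?expn_gt0 ?n0//; lra.
Qed.
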